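(* Let $a,u$ be coprime positive integers with $a\neq u$. Then $P_{a,u}(t)$ does not factor in $\mathbb{Z}[t]$ as a product of a polynomial of degree $2$ and a polynomial of degree $6$.
   Context: For positive integers $a,u$, put $\Delta=u^{2}-a^{2}$ and define the even monic polynomial $$P_{a,u}(t)=t^{8}+6\Delta\,t^{6}+(\Delta^{2}-2a^{2}u^{2})\,t^{4}-6\Delta\,a^{2}u^{2}\,t^{2}+a^{4}u^{4}\in\mathbb{Z}[t].$$ *)

(* Defs.v *)
From mathcomp Require Import all_boot all_order all_algebra.

Set Implicit Arguments.
Unset Strict Implicit.
Unset Printing Implicit Defensive.

Import GRing.Theory.
Local Open Scope ring_scope.

(* The subtraction is taken in int, so Delta may be negative. *)
Definition Delta (a u : nat) : int := u%:Z ^+ 2 - a%:Z ^+ 2.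

Definition Ppoly (a u : nat) : {poly int} :=
  'X^8
  + (6 * Delta a u) *: 'X^6
  + (Delta a u ^+ 2 - 2 * a%:Z ^+ 2 * u%:Z ^+ 2) *: 'X^4
  - (6 * Delta a u * a%:Z ^+ 2 * u%:Z ^+ 2) *: 'X^2
  + (a%:Z ^+ 4 * u%:Z ^+ 4)%:P.

(* Main.v *)
Require Import Defs.
From mathcomp Require Import all_boot all_order all_algebra.
From mathcomp Require Import zify ring.

(** Write [m = a u], [D = Delta a u].  Dividing [Ppoly a u] by [t^4] and putting
    [v = t^2 - m^2 / t^2] turns it into [v^2 + 6 D v + D^2], whose discriminant
    [32 D^2] is not a square, since [D <> 0].  Hence [Ppoly a u], as a quartic in
    [s = t^2], has no rational root.

    Since [Ppoly a u] is even, a quadratic factor [t^2 + b t + c] with [b <> 0]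
    comes together with its image under [t -> -t], so that [s^2 - T s + c^2], with
    [T = b^2 - 2 c], divides that quartic
    ([even_octic_quadratic_factor]).  When [b = 0], the value [s = - c] would be
    a root of it.  When [b <> 0], comparing coefficients gives
      [T (m^2 - c^2) = 6 D c^2] and [c^2 (T^2 + 6 D T + D^2) = (c^2 + m^2)^2],
    and eliminating [T] shows that [(c^2 - m^2)^2 + 36 c^2 m^2] is a square.
    With [x = c^2 - m^2] and [w = 2 c m], both [x^2 + w^2 = (c^2 + m^2)^2] and
    [x^2 + 9 w^2] are then squares ([no_quadratic_factor_relations]).

    The arithmetic core is that [x^2 + w^2] and [x^2 + 9 w^2] are never both
    squares when [x w <> 0] ([concordant_1_9]): in classical terms, 1 and 9 are
    not concordant, because the elliptic curve [Y^2 = X (X + 1) (X + 9)] has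
    rank 0.  The proof is a descent of Fermat's kind.  After reducing to [x], [w]
    coprime and [x] prime to 3, both [(x, w)] and [(x, 3 w)] are legs of
    primitive Pythagorean triples.  Comparing the two parametrisations gives an
    equation [r s = p q] up to a factor 3, which splits as [r = a b], [s = c d],
    [p = a c], [q = b d]; the remaining equation then separates into a pair of
    quadratic equations whose common factor is a divisor of 8, and congruences
    modulo 8 leave only a smaller solution of the original system.  Hence
    [x w = 0], so [c^2 = m^2], and then [6 D c^2 = 0], which is absurd. *)

Set Implicit Arguments.
Unset Strict Implicit.
Unset Printing Implicit Defensive.

Import Order.TTheory GRing.Theory Num.Theory.

Local Open Scope nat_scope.

(** * Coprimality and squares of natural numbers *)

Lemma coprime_odd (m n : nat) : coprime m n -> odd m || odd n.
Proof.
move=> cmn; apply: contraT; rewrite negb_or => /andP[em en].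
have: 2 %| gcdn m n by rewrite dvdn_gcd !dvdn2 em en.
by rewrite (eqP cmn).
Qed.

Lemma gcdn_cofactors (m n : nat) : 0 < m -> exists m' n',
  [/\ m = gcdn m n * m', n = gcdn m n * n' & coprime m' n'].
Proof.
move=> m0; have g0 : 0 < gcdn m n by rewrite gcdn_gt0 m0.
have /dvdnP[m' em] := dvdn_gcdl m n; have /dvdnP[n' en] := dvdn_gcdr m n.
exists m', n'; split; rewrite 1?mulnC // /coprime.
by rewrite -(eqn_pmul2l g0) muln_gcdr muln1 ![gcdn m n * _]mulnC -em -en.
Qed.

Lemma sqr_mod8 (n : nat) : exists k, n ^ 2 = if odd n then 8 * k + 1 else 4 * k.
Proof.
have := odd_double_half n; case: (odd n) => /= <-; last first.
  by exists (n./2 ^ 2); rewrite -muln2; ring.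
have [t ht] : exists t, n./2 * n./2.+1 = 2 * t.
  exists (n./2 * n./2.+1)./2; rewrite mul2n halfK oddM oddS.
  by case: (odd _) => //=; rewrite subn0.
by exists t; rewrite -muln2; nia.
Qed.

Lemma sqr_eq_double_sqr (x y : nat) : x ^ 2 = 2 * y ^ 2 -> y = 0.
Proof.
move=> e; case: (posnP y) => // y0.
have := congr1 (logn 2) e; rewrite lognM ?expn_gt0 ?y0 // !lognX.
have -> : logn 2 2 = 1 by exact: (@pfactorK 2 1 isT).
lia.
Qed.

(** The root is [gcdn A C]: dividing [A] and [C] by it leaves coprime cofactors,
    and the cofactor of [A] then both divides and is divided by it. *)
Lemma coprime_mul_sqr (A B C : nat) :
  coprime A B -> A * B = C ^ 2 -> exists r, A = r ^ 2.
Proof.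
move=> cAB eABC; case: (posnP A) => [->|A0]; first by exists 0.
have [al [ga [eA eC cag]]] := gcdn_cofactors C A0.
set g := gcdn A C in eA eC; have g0 : 0 < g by rewrite gcdn_gt0 A0.
have e : al * B = g * ga ^ 2.
  by apply/eqP; rewrite -(eqn_pmul2l g0) mulnA -eA eABC eC; apply/eqP; ring.
have d1 : al %| g.
  by rewrite -(Gauss_dvdl g (coprimeXr 2 cag)) -e dvdn_mulr.
have d2 : g %| al.
  have cgB : coprime g B by apply: coprime_dvdl cAB; rewrite dvdn_gcdl.
  by rewrite -(Gauss_dvdl al cgB) e dvdn_mulr.
by exists g; rewrite {1}eA (_ : al = g) ?mulnn //; apply/eqP; rewrite eqn_dvd d1.
Qed.

(** Two factorisations of the same number have a common refinement; here
    [a = gcdn r p]. *)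
Lemma common_refinement (r s p q : nat) : 0 < r -> r * s = p * q ->
  exists a b c d, [/\ r = a * b, s = c * d, p = a * c & q = b * d].
Proof.
move=> r0 e; have [b [c [er ep cbc]]] := gcdn_cofactors p r0.
set a := gcdn r p in er ep; have a0 : 0 < a by rewrite gcdn_gt0 r0.
have e2 : b * s = c * q.
  by apply/eqP; rewrite -(eqn_pmul2l a0) !mulnA -er -ep e.
have /dvdnP[d eq] : b %| q by rewrite -(Gauss_dvdr q cbc) -e2 dvdn_mulr.
exists a, b, c, d; split=> //; last by rewrite eq mulnC.
have b0 : 0 < b by move: r0; rewrite er muln_gt0 => /andP[].
by apply/eqP; rewrite -(eqn_pmul2l b0) e2 eq; apply/eqP; ring.
Qed.

Lemma coprime_cross_sqr (b g A B : nat) : 0 < g -> coprime b g ->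
  b ^ 2 * A = g ^ 2 * B -> exists k, A = k * g ^ 2 /\ B = k * b ^ 2.
Proof.
move=> g0 cbg e.
have cgb : coprime (g ^ 2) (b ^ 2) by rewrite coprimeXl ?coprimeXr // coprime_sym.
have /dvdnP[k eA] : g ^ 2 %| A by rewrite -(Gauss_dvdr A cgb) e dvdn_mulr.
exists k; split=> //; apply/eqP; have g20 : 0 < g ^ 2 by rewrite expn_gt0 g0.
by rewrite -(eqn_pmul2l g20) -e eA; apply/eqP; ring.
Qed.

Lemma coprime_sqr_dvd8 (x w k : nat) : coprime x w ->
  k %| 8 * x ^ 2 -> k %| 8 * w ^ 2 -> k \in [:: 1; 2; 4; 8].
Proof.
move=> cxw dx dw.
have: k %| gcdn (8 * x ^ 2) (8 * w ^ 2) by rewrite dvdn_gcd dx dw.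
rewrite -muln_gcdr; have /eqP -> : coprime (x ^ 2) (w ^ 2).
  by rewrite coprimeXl ?coprimeXr.
by rewrite -[_ * 1]/8 dvdn_divisors.
Qed.

(** * Descent for the concordant system *)

(** With [A = (z + x) / 2] and [B = (z - x) / 2], coprime because their sum and
    difference are, [A B = (w / 2)^2] makes both of them squares.  The equation
    for [x] is written without a truncated subtraction. *)
Lemma primitive_pythagoras (x w z : nat) : coprime x w -> ~~ odd w ->
  x ^ 2 + w ^ 2 = z ^ 2 ->
  exists r s, [/\ x + s ^ 2 = r ^ 2, w = 2 * (r * s), coprime r s & odd (r + s)].
Proof.
move=> cxw ew e.
have ox : odd x by have := coprime_odd cxw; rewrite (negbTE ew) orbF.
have oz : odd z.
  have := congr1 odd e; rewrite oddD !oddX /= ox (negbTE ew) /=.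
  by case: (odd z).
have lexz : x <= z by rewrite -leq_sqr -e leq_addr.
have [A [B [ez ex]]] : exists A B, z = A + B /\ A = x + B.
  exists (x + (z - x)./2), (z - x)./2; split=> //.
  have : ~~ odd (z - x) by rewrite oddB // oz ox.
  by move=> h; have := even_halfK h; lia.
have [v ev] : exists v, w = 2 * v by exists w./2; rewrite mul2n even_halfK.
have eAB : A * B = v ^ 2 by move: e; rewrite ez ev ex; nia.
have cAB : coprime A B.
  rewrite /coprime -dvdn1; set g := gcdn A B.
  have gA : g %| A by apply: dvdn_gcdl.
  have gB : g %| B by apply: dvdn_gcdr.
  have gx : g %| x by rewrite -(dvdn_addl x gB) -ex.
  have cgw : coprime g w by apply: coprime_dvdl cxw.
  have gw : g %| w ^ 2.
    have -> : w ^ 2 = A * (4 * B) by rewrite ev expnMn -eAB; ring.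
    by rewrite dvdn_mulr.
  by rewrite -(Gauss_dvdr 1 (coprimeXr 2 cgw)) muln1.
have [r eA] := coprime_mul_sqr cAB eAB.
have [s eB] : exists s, B = s ^ 2.
  by apply: (@coprime_mul_sqr B A v); rewrite 1?coprime_sym // mulnC.
exists r, s; split.
- by rewrite -eA -eB -ex.
- by rewrite ev; congr muln; apply/eqP; rewrite -(eqn_exp2r _ _ (isT : 0 < 2)) -eAB eA eB expnMn.
- by move: cAB; rewrite eA eB coprime_pexpl // coprime_pexpr.
- by move: oz; rewrite ez eA eB !oddD !oddX.
Qed.

(** The final step of the descent.  By coprimality the equation says that
    [a^2 + d^2 = k g^2] and [9 a^2 + d^2 = k b^2]; eliminating [b] or [g] shows
    that [k] divides [8 a^2] and [8 d^2], hence 8, and the residues of squares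
    modulo 8, together with [a] and [d] not both being even, rule out every [k]
    but 1. *)
Lemma concordant_quotient (a d b g : nat) : 0 < g -> coprime a d -> coprime b g ->
  b ^ 2 * (a ^ 2 + d ^ 2) = g ^ 2 * (9 * a ^ 2 + d ^ 2) ->
  d ^ 2 + a ^ 2 = g ^ 2 /\ d ^ 2 + 9 * a ^ 2 = b ^ 2.
Proof.
move=> g0 cad cbg e.
have [k [e1 e2]] := coprime_cross_sqr g0 cbg e.
have := @coprime_sqr_dvd8 a d k cad.
have -> : 8 * a ^ 2 = k * (b ^ 2 - g ^ 2) by rewrite mulnBr -e1 -e2; lia.
have -> : 8 * d ^ 2 = k * (9 * g ^ 2 - b ^ 2) by rewrite mulnBr mulnCA -e1 -e2; lia.
rewrite !dvdn_mulr // => /(_ isT isT) hk.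
have oad := coprime_odd cad.
have [ka ha] := sqr_mod8 a; have [kb hb] := sqr_mod8 b.
have [kg hg] := sqr_mod8 g; have [kd hd] := sqr_mod8 d.
move: hk e1 e2; rewrite !inE; rewrite ha hb hg hd.
move: oad; case: (odd a); case: (odd b); case: (odd g); case: (odd d) => //= _;
  by case/or4P=> /eqP->; lia.
Qed.

(** The same analysis with the forms [a^2 + 3 d^2] and [3 a^2 + d^2] leaves no
    case at all.  If [a] and [d] have opposite parities, both forms are odd, so
    [k = 1], but one of them is 3 modulo 4.  If [a] and [d] are odd, both forms
    are 4 modulo 8: then [k = 1] makes [b] and [g] even, [k = 4] makes all four
    numbers odd, and [k = 2], [k = 8] are impossible.  The all-odd case has to be
    excluded by hypothesis because [a = b = g = d = 1] is a solution. *)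
Lemma no_3_1_quotient (a d b g : nat) : 0 < g -> coprime a d -> coprime b g ->
  ~~ [&& odd a, odd b, odd g & odd d] ->
  b ^ 2 * (3 * a ^ 2 + d ^ 2) = g ^ 2 * (a ^ 2 + 3 * d ^ 2) -> False.
Proof.
move=> g0 cad cbg hodd e.
have [k [e1 e2]] := coprime_cross_sqr g0 cbg e.
have := @coprime_sqr_dvd8 a d k cad.
have -> : 8 * a ^ 2 = k * (3 * g ^ 2 - b ^ 2) by rewrite mulnBr mulnCA -e1 -e2; lia.
have -> : 8 * d ^ 2 = k * (3 * b ^ 2 - g ^ 2) by rewrite mulnBr mulnCA -e1 -e2; lia.
rewrite !dvdn_mulr // => /(_ isT isT) hk.
have oad := coprime_odd cad; have obg := coprime_odd cbg.
have [ka ha] := sqr_mod8 a; have [kb hb] := sqr_mod8 b.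
have [kg hg] := sqr_mod8 g; have [kd hd] := sqr_mod8 d.
move: hk e1 e2; rewrite !inE; rewrite ha hb hg hd.
move: oad obg hodd; case: (odd a); case: (odd b); case: (odd g); case: (odd d) => //= _ _ _;
  by case/or4P=> /eqP->; lia.
Qed.

(** Strong induction on [x * w].  The common divisor of [x] and [w] can be
    divided out, and when [x = 3 x'] the pair [(w, x')] is a smaller solution.
    Otherwise both Pythagorean triples are primitive and share their even leg,
    [x] or [w] (up to the factor 3).  If it is [x], then [r s = p q] and
    [3 (r^2 - s^2) = p^2 - q^2], which [no_3_1_quotient] refutes; if it is [w],
    then [3 r s = p q] and [r^2 - s^2 = p^2 - q^2], and [concordant_quotient]
    yields a solution with product [a d], a proper divisor of [w]. *)
Lemma concordant_1_9 (x w z y : nat) :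
  x ^ 2 + w ^ 2 = z ^ 2 -> x ^ 2 + 9 * w ^ 2 = y ^ 2 -> x * w = 0.
Proof.
have [n] := ubnP (x * w).
elim: n => // n IHn in x w z y * => /ltnSE lexw ez ey.
case: (posnP (x * w)) => // xw0.
have [x0 w0] : 0 < x /\ 0 < w by apply/andP; rewrite -muln_gt0.
have IH x' w' z' y' : x' * w' < x * w -> x' ^ 2 + w' ^ 2 = z' ^ 2 ->
    x' ^ 2 + 9 * w' ^ 2 = y' ^ 2 -> x' * w' = 0.
  by move=> lt; apply: IHn; apply: leq_trans lt lexw.
have [cxw|ncxw] := boolP (coprime x w); last first.
  set g := gcdn x w in ncxw; have g0 : 0 < g by rewrite gcdn_gt0 x0.
  have g1 : 1 < g by rewrite ltn_neqAle eq_sym ncxw.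
  have /dvdnP[x' ex] : g %| x by apply: dvdn_gcdl.
  have /dvdnP[w' ew] : g %| w by apply: dvdn_gcdr.
  have /dvdnP[z' ez'] : g %| z.
    by rewrite -(dvdn_pexp2r _ _ (isT : 0 < 2)) -ez ex ew !expnMn -mulnDl dvdn_mull.
  have /dvdnP[y' ey'] : g %| y.
    by rewrite -(dvdn_pexp2r _ _ (isT : 0 < 2)) -ey ex ew !expnMn mulnA -mulnDl dvdn_mull.
  have g20 : 0 < g ^ 2 by rewrite expn_gt0 g0.
  have exw : x * w = x' * w' * g ^ 2 by rewrite ex ew; ring.
  rewrite exw (IH x' w' z' y') //.
  - rewrite exw ltn_Pmulr //; first by rewrite -[1](exp1n 2) ltn_sqr.
    by move: xw0; rewrite exw muln_gt0 => /andP[].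
  - by apply/eqP; rewrite -(eqn_pmul2r g20) mulnDl -!expnMn -ex -ew -ez' ez.
  - by apply/eqP; rewrite -(eqn_pmul2r g20) mulnDl -mulnA -!expnMn -ex -ew -ey' ey.
have [/dvdnP[x' ex]|n3x] := boolP (3 %| x).
  have /dvdnP[y' ey'] : 3 %| y.
    have : 3 %| y ^ 2.
      by rewrite -ey ex expnMn; apply: dvdn_add; [apply: dvdn_mull|apply: dvdn_mulr].
    by rewrite Euclid_dvdX // andbT.
  have : w * x' = 0.
    by apply: (IH w x' y' z); move: ez ey xw0; rewrite ex ?ey'; nia.
  by rewrite ex; nia.
have c3wx : coprime (3 * w) x by rewrite coprimeMl prime_coprime // n3x coprime_sym.
have [ow|ew] := boolP (odd w).
  have ex : ~~ odd x.
    apply/negP=> ox; have [kx hx] := sqr_mod8 x; have [kw hw] := sqr_mod8 w.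
    have [kz hz] := sqr_mod8 z; move: ez; rewrite hx hw hz ox ow.
    by case: (odd z); lia.
  have cwx : coprime w x by rewrite coprime_sym.
  have [|r [s [ers exrs crs ors]]] := @primitive_pythagoras w x z cwx ex.
    by rewrite addnC.
  have [|p [q [epq expq cpq opq]]] := @primitive_pythagoras (3 * w) x y c3wx ex.
    by rewrite -ey; ring.
  have r0 : 0 < r by move: x0; rewrite exrs !muln_gt0 => /and3P[].
  have ers_pq : r * s = p * q by lia.
  have [a [b [c [d [er es ep eq]]]]] := common_refinement r0 ers_pq.
  have p0 : 0 < p by move: x0; rewrite expq !muln_gt0 => /and3P[].
  exfalso; apply: (@no_3_1_quotient a d b c).
  - by move: p0; rewrite ep muln_gt0 => /andP[].
  - by move: crs; rewrite er es coprimeMl !coprimeMr => /andP[/andP[_ ->]].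
  - by move: crs; rewrite er es coprimeMl !coprimeMr => /andP[_ /andP[->]].
  - move: ors; rewrite er es oddD !oddM.
    by case: (odd a); case: (odd b); case: (odd c); case: (odd d).
  - transitivity (3 * r ^ 2 + q ^ 2); first by rewrite er eq; ring.
    transitivity (p ^ 2 + 3 * s ^ 2); first by rewrite -ers -epq; ring.
    by rewrite ep es; ring.
have cx3w : coprime x (3 * w) by rewrite coprime_sym.
have [r [s [ers exrs crs ors]]] := @primitive_pythagoras x w z cxw ew ez.
have [||p [q [epq expq cpq opq]]] := @primitive_pythagoras x (3 * w) y cx3w.
- by rewrite oddM.
- by rewrite -ey; ring.
have [r0 s0] : 0 < r /\ 0 < s by move: w0; rewrite exrs !muln_gt0 => /and3P[].
have epq3 : 3 * (r * s) = p * q by lia.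
have /orP[/dvdnP[p' ep']|/dvdnP[q' eq']] : (3 %| p) || (3 %| q).
  by rewrite -Euclid_dvdM // -epq3 dvdn_mulr.
- have ers_pq : r * s = p' * q by lia.
  have [a [b [c [d [er es ep eq]]]]] := common_refinement r0 ers_pq.
  have := r0; have := s0; rewrite {1}er {1}es !muln_gt0 => /andP[c0 d0] /andP[a0 b0].
  have [|||e1 e2] := @concordant_quotient a d b c c0.
  - by move: crs; rewrite er es coprimeMl !coprimeMr => /andP[/andP[_ ->]].
  - by move: crs; rewrite er es coprimeMl !coprimeMr => /andP[_ /andP[->]].
  - transitivity (r ^ 2 + q ^ 2); first by rewrite er eq; ring.
    transitivity (p ^ 2 + s ^ 2); first by rewrite -ers -epq; ring.
    by rewrite ep' ep es; ring.
  have da0 : 0 < d * a by rewrite muln_gt0 d0.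
  have lt : d * a < x * w.
    apply: (@leq_trans w); last by rewrite leq_pmull.
    have -> : w = 2 * (b * c) * (d * a) by rewrite exrs er es; ring.
    have bc0 : 0 < b * c by rewrite muln_gt0 b0.
    by rewrite ltn_Pmull // mul2n -addnn; exact: (leq_add bc0 bc0).
  by move: da0; rewrite (IH _ _ _ _ lt e1 e2).
have ers_pq : r * s = p * q' by lia.
have [a [b [c [d [er es ep eq]]]]] := common_refinement r0 ers_pq.
have := r0; have := s0; rewrite {1}er {1}es !muln_gt0 => /andP[c0 d0] /andP[a0 b0].
have [|||e1 e2] := @concordant_quotient d a c b b0.
- by move: crs; rewrite coprime_sym er es coprimeMl !coprimeMr => /andP[_ /andP[->]].
- by move: crs; rewrite coprime_sym er es coprimeMl !coprimeMr => /andP[/andP[_ ->]].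
- transitivity (p ^ 2 + s ^ 2); first by rewrite ep es; ring.
  transitivity (r ^ 2 + q ^ 2); first by rewrite -ers -epq; ring.
  by rewrite er eq' eq; ring.
have da0 : 0 < a * d by rewrite muln_gt0 a0.
have lt : a * d < x * w.
  apply: (@leq_trans w); last by rewrite leq_pmull.
  have -> : w = 2 * (b * c) * (a * d) by rewrite exrs er es; ring.
  have bc0 : 0 < b * c by rewrite muln_gt0 b0.
  by rewrite ltn_Pmull // mul2n -addnn; exact: (leq_add bc0 bc0).
by move: da0; rewrite (IH _ _ _ _ lt e1 e2).
Qed.

Local Open Scope ring_scope.

(** * Transfer to the integers *)

Lemma concordant_1_9_int (x w z y : int) :
  x ^+ 2 + w ^+ 2 = z ^+ 2 -> x ^+ 2 + 9 * w ^+ 2 = y ^+ 2 -> x * w = 0.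
Proof.
have absz_sqr (t : int) : ((`|t| ^ 2)%N)%:Z = t ^+ 2.
  by rewrite -abszX abszE ger0_norm ?sqr_ge0.
move=> ez ey; have : (`|x| * `|w| = 0)%N.
  apply: (@concordant_1_9 _ _ `|z|%N `|y|%N); apply/eqP; rewrite -eqz_nat PoszD.
    by rewrite !absz_sqr ez.
  by rewrite (PoszM 9) !absz_sqr ey.
by rewrite -abszM => /eqP; rewrite absz_eq0 => /eqP.
Qed.

Lemma sqr_eq_double_sqr_int (x y : int) : x ^+ 2 = 2 * y ^+ 2 -> y = 0.
Proof.
move=> e; apply/eqP; rewrite -absz_eq0; apply/eqP.
apply: (@sqr_eq_double_sqr `|x|%N); by rewrite -!abszX e abszM.
Qed.

Lemma dvdz_sqr (m n : int) : (m ^+ 2 %| n ^+ 2)%Z = (m %| n)%Z.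
Proof. by rewrite !dvdzE !abszX dvdn_pexp2r. Qed.

(** * Quadratic factors of an even octic polynomial *)

(** The first alternative is the case [b = 0], where the quartic in [s = t^2]
    vanishes at [s = - c].  The second one says that this quartic equals
    [(s^2 - T s + c^2) (s^2 + k s + l)], whose first factor is, in [t], the
    product of [t^2 + b t + c] and [t^2 - b t + c]. *)
Lemma even_octic_quadratic_factor (R : idomainType) (e f g h b c : R) (S : {poly R}) :
  (size S <= 7)%N ->
  'X^8 + e *: 'X^6 + f *: 'X^4 + g *: 'X^2 + h%:P
    = ('X^2 + b *: 'X + c%:P) * S ->
  c ^+ 4 - e * c ^+ 3 + f * c ^+ 2 - g * c + h = 0 \/
  (let T := b ^+ 2 - 2 * c in exists k l,
     [/\ k - T = e, l - k * T + c ^+ 2 = f,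
         k * c ^+ 2 - l * T = g & l * c ^+ 2 = h]).
Proof.
move=> szS ePS.
have E i : ('X^8 + e *: 'X^6 + f *: 'X^4 + g *: 'X^2 + h%:P)`_i
    = (if (i < 2)%N then 0 else S`_(i - 2)) +
      b * (if i == 0%N then 0 else S`_i.-1) + c * S`_i.
  by rewrite ePS !mulrDl !coefD -scalerAl coefZ coefXnM coefXM coefCM.
have s8 : S`_8 = 0 by rewrite nth_default // (leq_trans szS).
have s7 : S`_7 = 0 by rewrite nth_default // (leq_trans szS).
have := (E 0, E 1, E 2, E 3, E 4, E 5, E 6, E 7, E 8)%N.
rewrite !coefD !coefZ !coefXn !coefC /= s8 s7.
move: S`_0 S`_1 S`_2 S`_3 S`_4 S`_5 S`_6 => s0 s1 s2 s3 s4 s5 s6.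
rewrite !(mulr0, mulr1, addr0, add0r) => -[[[[[[[[E0 E1] E2] E3] E4] E5] E6] E7] E8].
set T := b ^+ 2 - 2 * c; pose k := e + T; pose l := f + k * T - c ^+ 2.
(* The top coefficients determine S, which is (t^2 - b t + c) (t^4 + k t^2 + l)
   up to an error s0 - c l in the constant term; by E1, b kills this error. *)
have x5 : s5 = - b by transitivity (s5 + b * s6 - b * s6); [ring | rewrite -E7 -E8; ring].
have x4 : s4 = k + c by rewrite /k /T E6 -E8 x5; ring.
have x3 : s3 = - b * k.
  by transitivity (s3 + b * s4 + c * s5 - b * s4 - c * s5);
    [ring | rewrite -E5 x4 x5; ring].
have x2 : s2 = l + c * k by rewrite /l E4 x3 x4 /T; ring.
have x1 : s1 = - b * l.
  by transitivity (s1 + b * s2 + c * s3 - b * s2 - c * s3);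
    [ring | rewrite -E3 x2 x3; ring].
have x0 : s0 = g + (b ^+ 2 - c) * l - c ^+ 2 * k.
  by rewrite E2 x1 x2; ring.
have : b * (g + T * l - k * c ^+ 2) = 0.
  by rewrite E1 x0 x1 /T; ring.
move/eqP; rewrite mulf_eq0 => /orP[/eqP b0|/eqP gE]; [left | right].
  by rewrite E0 x0 /l /k /T b0; ring.
exists k, l; split; [by rewrite /k; ring | by rewrite /l; ring | |].
- transitivity (g - (g + T * l - k * c ^+ 2)); first by ring.
  by rewrite gE subr0.
- transitivity (h - c * (g + T * l - k * c ^+ 2)); last by rewrite gE mulr0 subr0.
  by rewrite E0 x0 /T; ring.
Qed.

(** The unknowns [k] and [l] are eliminated with the relations for [s^3] and
    [s^2].  The relation for [s], multiplied by [c^2] and combined with the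
    constant term, then becomes [trace] after cancelling [c^2 + m^2], and the
    constant term itself becomes [norm].  Multiplying [norm] by
    [(m^2 - c^2)^2] and substituting [trace] eliminates [T] and gives [key],
    which makes [x^2 + 9 w^2] a square for [x = c^2 - m^2], [w = 2 c m];
    [x^2 + w^2] is one identically. *)
Lemma no_quadratic_factor_relations (D m b c k l : int) : m != 0 -> D != 0 ->
  let T := b ^+ 2 - 2 * c in
  k - T = 6 * D -> l - k * T + c ^+ 2 = D ^+ 2 - 2 * m ^+ 2 ->
  k * c ^+ 2 - l * T = - (6 * D * m ^+ 2) -> l * c ^+ 2 = m ^+ 4 -> False.
Proof.
move=> m0 D0 T ek el eg eh.
have c0 : c != 0.
  apply/negP=> /eqP c0; move/eqP: eh; rewrite c0 expr0n mulr0 eq_sym.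
  by rewrite expf_eq0 (negbTE m0).
have kE : k = T + 6 * D by rewrite -ek; ring.
have lE : l = D ^+ 2 - 2 * m ^+ 2 + k * T - c ^+ 2 by rewrite -el; ring.
have m2 : 0 < m ^+ 2 by rewrite exprn_even_gt0.
have c2 : 0 < c ^+ 2 by rewrite exprn_even_gt0.
have trace : T * (m ^+ 2 - c ^+ 2) = 6 * D * c ^+ 2.
  have cm0 : c ^+ 2 + m ^+ 2 != 0 by rewrite gt_eqF // addr_gt0.
  apply: (mulfI cm0).
  transitivity (T * (m ^+ 4 - c ^+ 4)); first by ring.
  rewrite -eh; apply/eqP; rewrite -subr_eq0; apply/eqP.
  transitivity (- c ^+ 2 * (k * c ^+ 2 - l * T + 6 * D * m ^+ 2)).
    by rewrite kE; ring.
  by rewrite eg; ring.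
have norm : c ^+ 2 * (T ^+ 2 + 6 * D * T + D ^+ 2) = (c ^+ 2 + m ^+ 2) ^+ 2.
  transitivity (m ^+ 4 + 2 * c ^+ 2 * m ^+ 2 + c ^+ 4); last by ring.
  by rewrite -eh lE kE; ring.
have key : (c ^+ 4 - m ^+ 4) ^+ 2 =
    (c * D) ^+ 2 * ((c ^+ 2 - m ^+ 2) ^+ 2 + 9 * (2 * c * m) ^+ 2).
  transitivity ((c ^+ 2 + m ^+ 2) ^+ 2 * (m ^+ 2 - c ^+ 2) ^+ 2); first by ring.
  rewrite -norm.
  transitivity (c ^+ 2 * ((T * (m ^+ 2 - c ^+ 2)) ^+ 2
    + 6 * D * (T * (m ^+ 2 - c ^+ 2)) * (m ^+ 2 - c ^+ 2)
    + D ^+ 2 * (m ^+ 2 - c ^+ 2) ^+ 2)); first by ring.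
  by rewrite trace; ring.
have cD0 : c * D != 0 by rewrite mulf_neq0.
have /dvdzP[y ey] : (c * D %| c ^+ 4 - m ^+ 4)%Z.
  by rewrite -dvdz_sqr key dvdz_mulr.
have : (c ^+ 2 - m ^+ 2) * (2 * c * m) = 0.
  apply: (@concordant_1_9_int _ _ (c ^+ 2 + m ^+ 2) y); first by ring.
  by apply: (mulfI (expf_neq0 2 cD0)); rewrite -key ey; ring.
move/eqP; rewrite !mulf_eq0 (negbTE m0) (negbTE c0) /= orbF => /eqP cm.
move/eqP: trace; rewrite -opprB cm oppr0 mulr0 eq_sym !mulf_eq0.
by rewrite (negbTE D0) (negbTE c0).
Qed.

Lemma Ppoly_no_quadratic_factor (a u : nat) (b c : int) (S : {poly int}) :
  (0 < a)%N -> (0 < u)%N -> a != u -> (size S <= 7)%N ->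
  Ppoly a u <> ('X^2 + b *: 'X + c%:P) * S.
Proof.
move=> a0 u0 neq szS; set m : int := a%:Z * u%:Z; set D := Delta a u.
have m0 : m != 0 by rewrite mulf_neq0 // eqz_nat -lt0n.
have D0 : D != 0.
  by rewrite subr_eq0 eqf_sqr negb_or; apply/andP; split; lia.
have -> : Ppoly a u = 'X^8 + (6 * D) *: 'X^6 + (D ^+ 2 - 2 * m ^+ 2) *: 'X^4
    + (- (6 * D * m ^+ 2)) *: 'X^2 + (m ^+ 4)%:P.
  by rewrite /Ppoly -/D scaleNr; congr (_ + _ *: _ - _ *: _ + _%:P); rewrite /m; ring.
case/(even_octic_quadratic_factor szS) => [e|[k [l [ek el eg eh]]]]; last first.
  exact: (no_quadratic_factor_relations m0 D0 ek el eg eh).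
(* Completing the square in v^2 + 6 D v + D^2, where v = (m^2 - c^2) / c. *)
have : (c ^+ 2 - m ^+ 2 - 3 * D * c) ^+ 2 = 2 * (2 * D * c) ^+ 2.
  by apply/eqP; rewrite -subr_eq0 -e; apply/eqP; ring.
move/sqr_eq_double_sqr_int/eqP; rewrite !mulf_eq0 (negbTE D0) /= => /eqP c0.
by move/eqP: e; rewrite c0 !(expr0n, mulr0, subr0, addr0, add0r) expf_eq0 (negbTE m0).
Qed.

(* [size p] is the degree of [p] plus one. *)
Theorem theorem7 (a u : nat) (ha : (0 < a)%N) (hu : (0 < u)%N)
    (hau : coprime a u) (hneq : a <> u) :
  ~ exists Q S : {poly int},
      size Q = 3%N /\ size S = 7%N /\ Ppoly a u = Q * S.
Proof.
case=> Q [S [szQ [szS e]]].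
have Q0 : Q != 0 by rewrite -size_poly_gt0 szQ.
have S0 : S != 0 by rewrite -size_poly_gt0 szS.
have lead1 : lead_coef Q * lead_coef S = 1.
  rewrite -lead_coefM lead_coefE size_mul // szQ szS -e /Ppoly.
  by rewrite !(coefB, coefD, coefZ, coefXn, coefC) /= !(mulr0, addr0, subr0).
have lQ : lead_coef Q ^+ 2 = 1.
  have /eqP : (`|lead_coef Q| * `|lead_coef S| = 1)%N by rewrite -abszM lead1.
  rewrite muln_eq1 => /andP[/eqP q1 _].
  by rewrite -[LHS]ger0_norm ?sqr_ge0 // normrX -abszE q1.
set q := lead_coef Q in lead1 lQ.
(* The leading coefficient q of Q is 1 or -1, so q Q is monic. *)
apply: (@Ppoly_no_quadratic_factor a u (q * Q`_1) (q * Q`_0) (q *: S)) => //.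
- exact/eqP.
- by rewrite -szS size_scale_leq.
rewrite e -scalerAr scalerAl; congr (_ * _); apply/polyP=> i.
rewrite coefZ !coefD coefXn coefZ coefX coefC.
case: i => [|[|[|i]]] /=; rewrite ?(mulr0, mulr1, addr0, add0r).
- by rewrite mulrA -expr2 lQ mul1r.
- by rewrite mulrA -expr2 lQ mul1r.
- by rewrite /q lead_coefE szQ.
- by rewrite nth_default ?mulr0 // szQ.
Qed.
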